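(* Let $\Omega$ and $\Lambda$ be non-empty sets, $v\colon\Lambda\to(0,\infty)$, $(E,\|\cdot\|_E)$ a normed space over $\mathbb{K}$, $\mathcal{G}(\Omega,E)$ a linear subspace of $E^\Omega$, $q^E\colon\mathcal{G}(\Omega,E)\to[0,\infty)$ a seminorm, $T^E\colon\mathcal{G}(\Omega,E)\to E^\Lambda$ a linear map, and set \[ \mathcal{F}v(\Omega,E):=\Bigl\{f\in\mathcal{G}(\Omega,E): \|f\|^E:=q^E(f)+\sup_{x\in\Lambda}\|T^E(f)(x)\|_E v(x)<\infty\Bigr\}. \] Suppose that $(\mathcal{F}v(\Omega,E),\|\cdot\|^E)$ is normed (i.e. $\|\cdot\|^E$ is a norm). Let $\mathcal{S}$ be a family of subsets of $\Lambda$ that is closed under finite unions with $\Lambda=\bigcup_{S\in\mathcal{S}}S$, and denote by $\tau_{\mathcal{S}}^E$ the locally convex Hausdorff topology generated by the directed system of seminorms \[ q_S^E(f):=q^E(f)+\sup_{x\in S}\|T^E(f)(x)\|_E v(x),\quad f\in\mathcal{F}v(\Omega,E), \] for $S\in\mathcal{S}$. Then the following assertions hold. (a) $(\mathcal{F}v(\Omega,E),\|\cdot\|^E,\tau_{\mathcal{S}}^E)$ is a Saks space. (b) If there is a sequence $(S_n)_{n\in\mathbb{N}}$ in $\mathcal{S}$ such that for every $S\in\mathcal{S}$ there is $N\in\mathbb{N}$ with $S\subset S_N$, then $(\mathcal{F}v(\Omega,E),\|\cdot\|^E,\tau_{\mathcal{S}}^E)$ is C-sequential. (c) The submixed topology $\gamma_{\mathrm{s}}(\|\cdot\|^E,\tau_{\mathcal{S}}^E)$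 is generated by the system of seminorms \[ |||f|||^E_{(S_n,a_n)_{n\in\mathbb{N}}}:=\sup_{n\in\mathbb{N}}\sup_{x\in S_n}\bigl(q^E(f)+\|T^E(f)(x)\|_E v(x)\bigr)a_n,\quad f\in\mathcal{F}v(\Omega,E), \] where $(S_n)_{n\in\mathbb{N}}$ is a sequence in $\mathcal{S}$ and $(a_n)_{n\in\mathbb{N}}\in c_0^+$. (d) If $\mathcal{S}=\mathcal{N}_\Lambda$, then $\gamma_{\mathrm{s}}(\|\cdot\|^E,\tau_{\mathcal{N}_\Lambda}^E)$ is generated by the system of seminorms \[ |||f|||^E_{(x_n,a_n)_{n\in\mathbb{N}}}:=\sup_{n\in\mathbb{N}}\bigl(q^E(f)+\|T^E(f)(x_n)\|_E v(x_n)\bigr)a_n,\quad f\in\mathcal{F}v(\Omega,E), \] where $(x_n)_{n\in\mathbb{N}}$ is a sequence in $\Lambda$ and $(a_n)_{n\in\mathbb{N}}\in c_0^+$. (e) Let $\Lambda$ be a completely regular Hausdorff space and set $\mathcal{W}_0:=\mathcal{W}^+_{\mathrm{b},0}(\Lambda)$ or $\mathcal{W}_0:=\mathcal{W}^+_{\mathrm{usc},0}(\Lambda)$. If $\mathcal{S}=\mathcal{K}_\Lambda$ and $\gamma(\|\cdot\|^E,\tau_{\mathcal{K}_\Lambda}^E)=\gamma_{\mathrm{s}}(\|\cdot\|^E,\tau_{\mathcal{K}_\Lambda}^E)$, then the mixed topology $\gamma(\|\cdot\|^E,\tau_{\mathcal{K}_\Lambda}^E)$ is generated by the system of seminorms \[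 |f|_w^E:=\sup_{x\in\Lambda}\bigl(q^E(f)+\|T^E(f)(x)\|_E v(x)\bigr)w(x),\quad f\in\mathcal{F}v(\Omega,E), \] for $w\in\mathcal{W}_0$. If $\Lambda$ is locally compact, we may replace $\mathcal{W}_0$ by $\mathcal{C}_0^+(\Lambda)$.
   Context: $\mathbb{K}\in\{\mathbb{R},\mathbb{C}\}$. $E^\Lambda$ is the space of all functions $\Lambda\to E$. Suprema of non-negative quantities over the empty set are $0$. $c_0^+$ is the family of real non-negative null-sequences. Saks spaces. Let $(X,\|\cdot\|)$ be a normed space and $\tau$ a locally convex Hausdorff topology on $X$ coarser than the norm topology $\tau_{\|\cdot\|}$. The mixed topology $\gamma=\gamma(\|\cdot\|,\tau)$ is the finest linear topology on $X$ that coincides with $\tau$ on $\|\cdot\|$-bounded sets and lies between $\tau$ and $\tau_{\|\cdot\|}$; it is locally convex Hausdorff. $(X,\|\cdot\|,\tau)$ is a Saks space if there is a directed system $\Gamma_\tau$ of continuous seminorms generating $\tau$ with $\|x\|=\sup_{q\in\Gamma_\tau}q(x)$ for all $x$. The submixed topology $\gamma_{\mathrm{s}}(\|\cdot\|,\tau)$ is generated by the seminorms $x\mapsto\sup_{n\in\mathbb{N}}q_n(x)a_n$ with $(q_n)_{n\in\mathbb{N}}\subset\Gamma_\tau$ and $(a_n)_{n\in\mathbb{N}}\in c_0^+$ (it does not depend on the choice of such $\Gamma_\tau$). A Saks space is C-sequential if every convex sequentially open subset of $(X,\gamma)$ is open. $\mathcal{N}_\Lambda$ is the family of finite subsets of $\Lambda$;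 if $\Lambda$ is a topological space, $\mathcal{K}_\Lambda$ is the family of compact subsets of $\Lambda$. For a completely regular Hausdorff space $\Lambda$, a function $w\colon\Lambda\to[0,\infty)$ vanishes at infinity if $\{x\in\Lambda: w(x)\ge\varepsilon\}$ is compact for every $\varepsilon>0$; $\mathcal{W}^+_{\mathrm{b},0}(\Lambda)$, $\mathcal{W}^+_{\mathrm{usc},0}(\Lambda)$ and $\mathcal{C}_0^+(\Lambda)$ are the families of all bounded, upper semicontinuous, resp. continuous functions $w\colon\Lambda\to[0,\infty)$ that vanish at infinity.
   Formalization: The submixed topology can depend on the choice of the directed system of seminorms generating τ, so in (c), (d), (e) it is taken with respect to the named system q_S^E, S∈𝒮, which is shown to be admissible. *)

(* Defs.v *)
From HB Require Import structures.
From mathcomp Require Import all_boot all_order all_algebra.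
From mathcomp Require Import all_classical all_reals all_analysis.
From mathcomp Require Import complex.

Set Implicit Arguments.
Unset Strict Implicit.
Unset Printing Implicit Defensive.

Import Order.TTheory GRing.Theory Num.Theory.
Import numFieldNormedType.Exports.

Local Open Scope classical_set_scope.
Local Open Scope ring_scope.

(** Several topologies on one vector space are compared below, so a topology is a
family of open sets and [topologized t] is the carrier equipped with [t]. *)

Record topology (X : Type) := Topology {
  is_open : set (set X) ;
  is_openT : is_open setT ;
  is_openI : setI_closed is_open ;
  is_open_bigU : forall F : set (set X),
    F `<=` is_open -> is_open (\bigcup_(A in F) A)
}.

Definition topologized (X : Type) (t : topology X) : Type := X.

Section topologized.
Context (X : Type) (t : topology X).

Let bigU (I : Type) (f : I -> set X) :
  (forall i, is_open t (f i)) -> is_open t (\bigcup_i f i).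
Proof.
move=> of_; have -> : \bigcup_i f i = \bigcup_(A in range f) A.
  by apply/seteqP; split => x [A] => [_ ?|[i _ <-] ?]; [exists (f A)|exists i].
by apply: is_open_bigU => _ [i _ <-].
Qed.

HB.instance Definition _ := gen_eqMixin (topologized t).
HB.instance Definition _ := gen_choiceMixin (topologized t).
HB.instance Definition _ := isOpenTopological.Build (topologized t)
  (@is_openT X t) (@is_openI X t) bigU.

End topologized.

Lemma open_topologized (X : Type) (t : topology X) :
  @open (topologized t) = is_open t.
Proof. by []. Qed.

Lemma topology_eq (X : Type) (t1 t2 : topology X) :
  is_open t1 = is_open t2 -> t1 = t2.
Proof.
case: t1 t2 => [U1 a1 b1 c1] [U2 a2 b2 c2] /= eU; subst U2.
by congr Topology; exact: Prop_irrelevance.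
Qed.

Definition coarser (X : Type) (t1 t2 : topology X) :=
  is_open t1 `<=` is_open t2.

Definition traces (X : Type) (t : topology X) (B : set X) : set (set X) :=
  [set U `&` B | U in is_open t].

Definition sequentially_open (X : Type) (t : topology X) (U : set X) :=
  forall (u : nat -> topologized t) (x : topologized t),
    U x -> u @ \oo --> x -> \forall n \near \oo, U (u n).

(** The coarsest topology finer than every member of [T]. *)
Section sup_topologies.
Context (X : Type) (T : set (topology X)).

Definition sup_open : set (set X) :=
  [set U | forall t, (forall s, T s -> coarser s t) -> is_open t U].

Lemma sup_openT : sup_open setT. Proof. by move=> t _; exact: is_openT. Qed.

Lemma sup_openI : setI_closed sup_open.
Proof. by move=> A B oA oB t Tt; apply: is_openI; [exact: oA|exact: oB]. Qed.

Lemma sup_open_bigU (F : set (set X)) : F `<=` sup_open ->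
  sup_open (\bigcup_(A in F) A).
Proof. by move=> Fop t Tt; apply: is_open_bigU => A /Fop; exact. Qed.

Definition sup_topologies : topology X :=
  Topology sup_openT sup_openI sup_open_bigU.

End sup_topologies.

Inductive scalars := RealScalars | ComplexScalars.

Definition scalar_field (R : realType) (k : scalars) : numFieldType :=
  if k is RealScalars then R else R[i].

(** Norms of modules over a numeric field [K] take their values in [K] itself;
for [K = R[i]] these values have zero imaginary part. *)
Definition to_real (R : realType) (k : scalars) : scalar_field R k -> R :=
  match k with
  | RealScalars => fun a => a
  | ComplexScalars => @complex.Re R
  end.

Definition real_norm (R : realType) (k : scalars)
  (V : normedZmodType (scalar_field R k)) (x : V) : R := to_real `|x|.

Section real_norm_theory.
Context (R : realType) (k : scalars).
Let K := scalar_field R k.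

Lemma to_real_le (a b : K) : a <= b -> to_real a <= to_real b.
Proof.
by rewrite /K in a b *; case: k a b => //= a b; rewrite lecE => /andP[].
Qed.

Lemma real_norm_ge0 (V : normedZmodType K) (x : V) : 0 <= real_norm x.
Proof.
have := to_real_le (normr_ge0 x); apply: le_trans.
by rewrite /K in V x *; case: k V x.
Qed.

Lemma real_norm0 (V : normedZmodType K) : real_norm (0 : V) = 0.
Proof. by rewrite /real_norm normr0; rewrite /K in V *; case: k V. Qed.

Lemma to_realD (a b : K) : to_real (a + b) = to_real a + to_real b.
Proof. by rewrite /K in a b *; case: k a b => // -[a c] [b d]. Qed.

Lemma to_realM (a b : K) : 0 <= a -> to_real (a * b) = to_real a * to_real b.
Proof.
rewrite /K in a b *; case: k a b => // -[a c] [b d] /=.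
by rewrite lecE /= => /andP[/eqP-> _]; rewrite mul0r subr0.
Qed.

Lemma real_norm_axpy (V : normedModType K) (a : K) (x y : V) :
  real_norm (a *: x + y) <= real_norm a * real_norm x + real_norm y.
Proof.
rewrite /real_norm -to_realM// -to_realD.
by apply: to_real_le; rewrite -normrZ ler_normD.
Qed.

End real_norm_theory.

Section seminorms.
Context (R : realType) (k : scalars).
Let K := scalar_field R k.
Context (X : lmodType K).

Definition is_seminorm (p : X -> R) :=
  [/\ forall x, 0 <= p x,
      forall x y, p (x + y) <= p x + p y &
      forall (a : K) x, p (a *: x) = real_norm a * p x].

Definition is_norm (p : X -> R) :=
  is_seminorm p /\ forall x, p x = 0 -> x = 0.

Section seminorm_topology.
Context (P : set (X -> R)).

Definition seminorm_open : set (set X) := [set U | forall x, U x ->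
  exists (F : set (X -> R)) (e : R), [/\ finite_set F, F `<=` P, 0 < e &
    [set y | forall p, F p -> p (y - x) < e] `<=` U]].

Lemma seminorm_openT : seminorm_open setT.
Proof. by move=> x _; exists set0, 1; split. Qed.

Lemma seminorm_openI : setI_closed seminorm_open.
Proof.
move=> A B oA oB x [/oA[F [e [fF FP e0 FA]]] /oB[G [d [fG GP d0 GB]]]].
exists (F `|` G), (Num.min e d); split.
- by rewrite finite_setU.
- by rewrite subUset.
- by rewrite lt_min e0.
- move=> y FGy; split; [apply: FA => p Fp|apply: GB => p Gp].
    by have := FGy p (or_introl Fp); rewrite lt_min => /andP[].
  by have := FGy p (or_intror Gp); rewrite lt_min => /andP[].
Qed.

Lemma seminorm_open_bigU (F : set (set X)) : F `<=` seminorm_open ->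
  seminorm_open (\bigcup_(A in F) A).
Proof.
move=> Fop x [A FA Ax]; have [G [e [fG GP e0 GA]]] := Fop _ FA _ Ax.
by exists G, e; split => // y /GA Ay; exists A.
Qed.

Definition seminorm_topology : topology X :=
  Topology seminorm_openT seminorm_openI seminorm_open_bigU.

End seminorm_topology.

Definition norm_topology (N : X -> R) : topology X :=
  seminorm_topology [set N].

Definition linear_topology (t : topology X) :=
  continuous (fun z : topologized t * topologized t =>
    (z.1 : X) + (z.2 : X) : topologized t) /\
  continuous (fun z : K^o * topologized t =>
    (z.1 : K) *: (z.2 : X) : topologized t).

Definition norm_bounded (N : X -> R) (B : set X) :=
  exists M : R, forall x, B x -> N x <= M.

(** The linear topologies between [tau] and the norm topology which coincide
with [tau] on the norm-bounded sets. *)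
Definition mixing_topology (N : X -> R) (tau t : topology X) :=
  [/\ linear_topology t,
      coarser tau t, coarser t (norm_topology N) &
      forall B, norm_bounded N B -> traces t B = traces tau B].

(** The supremum of these topologies is one of them, by [mixed_topologyP], so
this is the finest one. *)
Definition mixed_topology (N : X -> R) (tau : topology X) : topology X :=
  sup_topologies (mixing_topology N tau).

Definition null_sequence (a : nat -> R) :=
  (forall n, 0 <= a n) /\ a n @[n --> \oo] --> (0 : R).

(** A directed system of seminorms as in the definition of a Saks space; the
seminorms are continuous because they generate [tau]. *)
Definition saks_system (N : X -> R) (tau : topology X) (Gam : set (X -> R)) :=
  [/\ forall q, Gam q -> is_seminorm q,
      Gam !=set0,
      forall p q, Gam p -> Gam q ->
        exists2 r, Gam r & forall x, p x <= r x /\ q x <= r x,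
      tau = seminorm_topology Gam &
      forall x, (N x)%:E = ereal_sup [set (q x)%:E | q in Gam]].

Definition saks_space (N : X -> R) (tau : topology X) :=
  [/\ is_norm N, hausdorff_space (topologized tau),
      coarser tau (norm_topology N) &
      exists Gam, saks_system N tau Gam].

Definition C_sequential (N : X -> R) (tau : topology X) :=
  forall U : set X, convex_set (U : set (convex_lmodType X)) ->
    sequentially_open (mixed_topology N tau) U ->
    is_open (mixed_topology N tau) U.

(** [Gam] is meant to satisfy [saks_system N tau Gam]; then [q n x <= N x], and
the suprema are finite. Two such systems for the same [N] and [tau] can give
different submixed topologies, so [Gam] is an argument. *)
Definition submixed_topology (Gam : set (X -> R)) : topology X :=
  seminorm_topology [set p | exists (q : nat -> X -> R) (a : nat -> R),
    [/\ forall n, Gam (q n), null_sequence a &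
        p = fun x => sup [set q n x * a n | n in [set: nat]]]].

Section mixed_topology_theory.
Context (N : X -> R) (tau : topology X).
Hypotheses (lin_tau : linear_topology tau)
  (tauN : coarser tau (norm_topology N)).

Let gam := mixed_topology N tau.

Let mixing_tau : mixing_topology N tau tau.
Proof. by split => //; exact: subset_refl. Qed.

Let mixing_mixed s : mixing_topology N tau s -> coarser s gam.
Proof. by move=> ms U sU t Tt; exact: Tt _ ms _ sU. Qed.

Let cvg_coarser (s t : topology X) (F : set_system X) (x : X) :
  coarser s t -> F --> (x : topologized t) -> F --> (x : topologized s).
Proof.
move=> st Fx A; rewrite /= [X in X A -> _]nbhsE => -[B [oB Bx] BA].
by apply: Fx; rewrite [X in X A]nbhsE; exists B => //; split => //; exact: st.
Qed.

Let continuous_mixed (Z : topologicalType) (f : Z -> X) :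
  (forall s, mixing_topology N tau s -> continuous (f : Z -> topologized s)) ->
  continuous (f : Z -> topologized gam).
Proof.
move=> cf; pose op : set (set X) := [set U | open (f @^-1` U)].
have opT : op setT by rewrite /op/= preimage_setT; exact: openT.
have opI : setI_closed op.
  by move=> A B oA oB; rewrite /op/= preimage_setI; exact: openI.
have opU (F : set (set X)) : F `<=` op -> op (\bigcup_(A in F) A).
  move=> Fop; rewrite /op/= preimage_bigcup.
  by apply: bigcup_open => A /Fop.
apply/continuousP => U oU; apply: (oU (Topology opT opI opU)).
by move=> s ms V sV; have /continuousP := cf s ms; exact.
Qed.

Lemma mixed_topologyP :
  mixing_topology N tau (mixed_topology N tau) /\
  forall t, mixing_topology N tau t -> coarser t (mixed_topology N tau).
Proof.
split; last exact: mixing_mixed.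
split.
- split; apply: continuous_mixed => s ms z.
  + have [[+ _] _ _ _] := ms => /(_ z); apply: cvg_trans.
    apply: cvg_app.
    case: z => x y A [[P Q] /= [nP nQ] PQA].
    by exists (P, Q) => //=; split;
      [exact: (cvg_coarser (mixing_mixed ms) cvg_id nP)
      |exact: (cvg_coarser (mixing_mixed ms) cvg_id nQ)].
  + have [[_ +] _ _ _] := ms => /(_ z); apply: cvg_trans.
    apply: cvg_app.
    case: z => x y A [[P Q] /= [nP nQ] PQA].
    by exists (P, Q) => //=; split => //;
      exact: (cvg_coarser (mixing_mixed ms) cvg_id nQ).
- exact: mixing_mixed.
- by move=> U; apply => s [].
- move=> B bB; apply/seteqP; split => _ [U oU <-]; last first.
    by exists U => //; exact: mixing_mixed oU.
  pose op : set (set X) := [set U | traces tau B (U `&` B)].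
  have opT : op setT by exists setT => //; exact: is_openT.
  have opI : setI_closed op.
    move=> A C [A' oA' AB] [C' oC' CB]; exists (A' `&` C').
      exact: is_openI.
    by rewrite setIIl AB CB -setIIl.
  have opU (F : set (set X)) : F `<=` op -> op (\bigcup_(A in F) A).
    move=> Fop.
    exists (\bigcup_(V in [set V | is_open tau V /\
        exists2 A, F A & V `&` B = A `&` B]) V).
      by apply: is_open_bigU => V [].
    rewrite !setI_bigcupl; apply/seteqP; split => x.
      move=> [V [_ [A FA VA]] VBx]; exists A => //.
      by rewrite -VA.
    move=> [A FA ABx]; have [V oV VA] := Fop _ FA.
    by exists V; [split => //; exists A|rewrite VA].
  by apply: (oU (Topology opT opI opU)) => s [_ _ _ sB] V sV;
    rewrite /op/= -(sB B bB); exists V.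
Qed.

End mixed_topology_theory.

End seminorms.

Section submodule_of.
Context (K : numFieldType) (V : lmodType K) (S : submodClosed V).

Definition submodule_of : Type := {x : V | x \in S}.

HB.instance Definition _ := SubChoice.on submodule_of.
HB.instance Definition _ := [SubChoice_isSubLmodule of submodule_of by <:].

End submodule_of.

Section weighted.
Context (R : realType) (k : scalars).
Let K := scalar_field R k.
Context (Omega Lambda : Type) (E : normedModType K)
  (G : submodClosed (Omega -> E)) (v : Lambda -> {posnum R})
  (T : {linear submodule_of G -> (Lambda -> E)}).

Definition weighted_value (f : submodule_of G) (x : Lambda) : R :=
  real_norm (T f x) * (v x)%:num.

Definition finite_weighted_sup : pred (submodule_of G) :=
  fun f => `[< has_ubound (range (weighted_value f)) >].

Lemma finite_weighted_sup_subproof : submod_closed finite_weighted_sup.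
Proof.
have eqD (a : K) (f g : submodule_of G) (x : Lambda) :
    weighted_value (a *: f + g) x <=
    real_norm a * weighted_value f x + weighted_value g x.
  rewrite /weighted_value linearP mulrA -mulrDl ler_wpM2r//.
  exact: real_norm_axpy.
split.
  apply/asboolP; exists 0 => _ [x _ <-].
  by rewrite /weighted_value linear0 real_norm0 mul0r.
move=> a f g /asboolP[M fM] /asboolP[L gL]; apply/asboolP.
exists (real_norm a * M + L) => _ [x _ <-].
apply: (le_trans (eqD a f g x)); apply: lerD; last by apply: gL; exists x.
by apply: ler_wpM2l; [exact: real_norm_ge0|apply: fM; exists x].
Qed.

HB.instance Definition _ := GRing.isSubmodClosed.Build K (submodule_of G)
  finite_weighted_sup finite_weighted_sup_subproof.

Definition weighted_space : lmodType K :=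
  submodule_of (GRing.SubmodClosed.clone K _ finite_weighted_sup _).

Context (q : submodule_of G -> R).

(** [sup] on [R] is [0] on the empty set, and on the unbounded ones; the sets
below are bounded when [a] and [w] are. *)
Definition weighted_seminorm (A : set Lambda) (f : weighted_space) : R :=
  q (val f) + sup [set weighted_value (val f) x | x in A].

Definition weighted_norm : weighted_space -> R := weighted_seminorm setT.

Definition weighted_system (S : set (set Lambda)) : set (weighted_space -> R) :=
  [set weighted_seminorm A | A in S].

Definition set_sequence_seminorm (A : nat -> set Lambda) (a : nat -> R)
    (f : weighted_space) : R :=
  sup [set sup [set (q (val f) + weighted_value (val f) x) * a n | x in A n]
      | n in [set: nat]].

Definition point_sequence_seminorm (x : nat -> Lambda) (a : nat -> R)
    (f : weighted_space) : R :=
  sup [set (q (val f) + weighted_value (val f) (x n)) * a n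
      | n in [set: nat]].

Definition weight_seminorm (w : Lambda -> R) (f : weighted_space) : R :=
  sup [set (q (val f) + weighted_value (val f) x) * w x
      | x in [set: Lambda]].

End weighted.

Section vanishing_weights.
Context (R : realType) (L : topologicalType).

Definition vanishes_at_infinity (w : L -> R) :=
  forall e : R, 0 < e -> compact [set x | e <= w x].

Definition upper_semicontinuous (w : L -> R) :=
  forall x a, w x < a -> \forall y \near x, w y < a.

Definition bounded_weights : set (L -> R) :=
  [set w : L -> R | [/\ forall x, 0 <= w x, has_ubound (range w) &
                        vanishes_at_infinity w]].

Definition usc_weights : set (L -> R) :=
  [set w : L -> R | [/\ forall x, 0 <= w x, upper_semicontinuous w &
                        vanishes_at_infinity w]].

Definition continuous_weights : set (L -> R) :=
  [set w : L -> R | [/\ forall x, 0 <= w x, continuous w &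
                        vanishes_at_infinity w]].

End vanishing_weights.

Arguments bounded_weights : clear implicits.
Arguments usc_weights : clear implicits.
Arguments continuous_weights : clear implicits.

(* Main.v *)
Require Import Defs.
From mathcomp Require Import all_boot all_order all_algebra.
From mathcomp Require Import all_classical all_reals all_analysis.
From mathcomp Require Import complex lra.

Set Implicit Arguments.
Unset Strict Implicit.
Unset Printing Implicit Defensive.

Import Order.TTheory GRing.Theory Num.Theory.
Import numFieldNormedType.Exports.

Local Open Scope classical_set_scope.
Local Open Scope ring_scope.

(** (b) A seminorm continuous for [tau] at 0 on every norm-ball belongs to a
mixing topology. If [U] is convex and sequentially open and [x] is in [U], the
balanced core of [U - x] contains, within each norm-ball, a [tau]-neighbourhood
of 0, because [tau] is first countable and null sequences in a ball are null for
the mixed topology; so its Minkowski functional is such a seminorm.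

(c), (d), (e) Each pair of systems dominates each other pointwise. For (e), a
null sequence [a] on compact sets [A n] is dominated by the weight
[sup_n a n * h n], with [h n] the indicator of [A n], or a compactly supported
Urysohn function equal to 1 on [A n]; it is semicontinuous and vanishes at
infinity because up to [e] only finitely many [n] matter. Conversely a weight is
dominated by a null sequence on its compact superlevel sets. *)

(** * Seminorm topologies *)

Section scalars_theory.
Context (R : realType) (k : scalars).
Let K := scalar_field R k.

(** Dilations and convex combinations below have real coefficients, while [X] is a module over [K]
    only. *)
Definition of_real : R -> K :=
  match k as k0 return R -> scalar_field R k0 with
  | RealScalars => id
  | ComplexScalars => real_complex R
  end.

Lemma of_realD (s t : R) : of_real (s + t) = of_real s + of_real t.
Proof. by rewrite /of_real /K; case: (k) => //=; rewrite raddfD. Qed.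

Lemma of_realB (s t : R) : of_real (s - t) = of_real s - of_real t.
Proof. by rewrite /of_real /K; case: (k) => //=; rewrite raddfB. Qed.

Lemma of_realM (s t : R) : of_real (s * t) = of_real s * of_real t.
Proof. by rewrite /of_real /K; case: (k) => //=; rewrite rmorphM. Qed.

Lemma of_real1 : of_real 1 = 1.
Proof. by rewrite /of_real /K; case: (k). Qed.

Lemma of_real_ge0 (t : R) : 0 <= t -> 0 <= of_real t.
Proof. by rewrite /of_real /K; case: (k) => //= t0; rewrite lecE /= eqxx. Qed.

Lemma of_real_le1 (t : R) : t <= 1 -> of_real t <= 1.
Proof. by rewrite /of_real /K; case: (k) => //= t1; rewrite lecE /= eqxx. Qed.

Lemma real_norm_of_real (t : R) : real_norm (of_real t : K) = `|t|.
Proof.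
have Re_norm : complex.Re `|t%:C%C| = `|t|.
  by rewrite normc_def /= expr0n addr0 sqrtr_sqr.
by rewrite /real_norm /of_real /K; case: (k).
Qed.

Lemma real_normM (a b : K) : real_norm (a * b : K) = real_norm a * real_norm b.
Proof. by rewrite /real_norm normrM to_realM. Qed.

Lemma real_norm_eq0 (a : K) : real_norm a = 0 -> a = 0.
Proof.
have Re_norm (c : R[i]) : complex.Re `|c| = 0 -> c = 0.
  by move=> c0; apply: normr0_eq0; move: c0; rewrite normc_def /= => ->.
rewrite /real_norm /K in a *; case: (k) a => /= a; first exact: normr0_eq0.
exact: Re_norm.
Qed.

(** Balls of [K^o] have radii in [K]. The ball of radius [of_real d] lies in the given set, because
    an inequality [<] in [R[i]] includes the one between real parts. *)
Lemma nbhs_real_norm (a : K) (d : R) : 0 < d ->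
  nbhs (a : K^o) [set b : K | real_norm (b - a : K) < d].
Proof.
move=> d0; apply/nbhs_ballP; exists (of_real d).
  move: d0; rewrite /of_real /K in a *; case: (k) a => //= a d0.
  by rewrite ltcE /= eqxx.
move=> b; rewrite -ball_normE /= distrC.
rewrite /real_norm /of_real /K in a b *; case: (k) a b => //= a b.
by rewrite ltcE /= => /andP[].
Qed.

End scalars_theory.

(** * Seminorms and the linear topologies they generate *)

Section seminorm_theory.
Context (R : realType) (k : scalars) (X : lmodType (scalar_field R k)).
Let K := scalar_field R k.
Implicit Types (p : X -> R) (P Q : set (X -> R)).

Lemma seminorm0 p : is_seminorm p -> p 0 = 0.
Proof. by case=> _ _ pZ; rewrite -(scale0r (0 : X)) pZ real_norm0 mul0r. Qed.

(** The homogeneity inequality for [a^-1] and [a *: x] is the reverse inequality for [a] and [x]. *)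
Lemma seminorm_of_le p : (forall x, 0 <= p x) ->
  (forall x y, p (x + y) <= p x + p y) ->
  (forall (a : K) x, p (a *: x) <= real_norm (a : K) * p x) -> is_seminorm p.
Proof.
move=> p0 pD pZ; split => // a x; apply: le_anti; rewrite pZ /=.
have [->|a0] := eqVneq a 0; first by rewrite real_norm0 mul0r.
have := pZ a^-1 (a *: x); rewrite scalerA mulVf// scale1r => h.
apply: (le_trans (ler_wpM2l (real_norm_ge0 _) h)).
by rewrite mulrA -real_normM divff// -(of_real1 R k) real_norm_of_real normr1 mul1r.
Qed.

Lemma seminormN p x : is_seminorm p -> p (- x) = p x.
Proof.
case=> _ _ pZ; rewrite -scaleN1r pZ.
rewrite (_ : -1 = - of_real k 1) ?of_real1// /real_norm normrN normr1.
by rewrite (_ : to_real 1 = 1) ?mul1r//; case: (k).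
Qed.

Lemma seminormB p x y : is_seminorm p -> p (x - y) = p (y - x).
Proof. by move=> sp; rewrite -opprB seminormN. Qed.

Lemma seminorm_dist p x y z : is_seminorm p -> p (x - z) <= p (x - y) + p (y - z).
Proof. by case=> _ pD _; apply: le_trans (pD _ _); rewrite addrA subrK. Qed.

Definition seminorm_ball (F : set (X -> R)) (x : X) (e : R) : set X :=
  [set y | forall p, F p -> p (y - x) < e].

(** By induction on an enumeration of [F], the ball is a finite intersection of balls of single
    seminorms, which are open by the triangle inequality. *)
Lemma seminorm_ball_open P (F : set (X -> R)) x e :
  (forall p, P p -> is_seminorm p) -> finite_set F -> F `<=` P ->
  seminorm_open P (seminorm_ball F x e).
Proof.
move=> sP /finite_seqP[s ->]; elim: s => [|p s IH] sub.
  rewrite (_ : seminorm_ball _ _ _ = setT); first exact: seminorm_openT.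
  by apply/seteqP; split.
rewrite (_ : seminorm_ball _ _ _ =
    [set y | p (y - x) < e] `&` seminorm_ball [set` s] x e); last first.
  apply/seteqP; split => y.
    move=> H; split; first by apply: H => /=; rewrite mem_head.
    by move=> r rs; apply: H; rewrite /= in_cons rs orbT.
  by case=> py sy r /=; rewrite in_cons => /predU1P[->//|]; exact: sy.
have Pp : P p by apply: sub; rewrite /= mem_head.
apply: seminorm_openI; last first.
  by apply: IH => r rs; apply: sub; rewrite /= in_cons rs orbT.
move=> y /= pye; exists [set p], (e - p (y - x)); split => //.
- by move=> _ ->.
- by rewrite subr_gt0.
- move=> z /(_ p erefl); rewrite ltrBrDr; apply: le_lt_trans.
  exact: seminorm_dist (sP _ Pp).
Qed.

Lemma nbhs_seminormP P (x : X) (A : set X) :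
  (forall p, P p -> is_seminorm p) ->
  nbhs (x : topologized (seminorm_topology P)) A <->
  exists F e, [/\ finite_set F, F `<=` P, 0 < e & seminorm_ball F x e `<=` A].
Proof.
move=> sP; rewrite nbhsE; split.
  move=> [B [/= oB Bx] BA]; have [F [e [fF FP e0 FB]]] := oB _ Bx.
  by exists F, e; split => //; apply: subset_trans BA.
move=> [F [e [fF FP e0 FA]]]; exists (seminorm_ball F x e) => //; split.
  exact: seminorm_ball_open.
by move=> p /FP/sP/seminorm0; rewrite subrr => ->.
Qed.

Lemma linear_seminorm_topology P : (forall p, P p -> is_seminorm p) ->
  linear_topology (seminorm_topology P).
Proof.
move=> sP; split.
  move=> [x y] A /(nbhs_seminormP _ _ sP)[F [e [fF FP e0 FA]]].
  have e20 : 0 < e / 2 by rewrite divr_gt0.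
  exists (seminorm_ball F x (e / 2), seminorm_ball F y (e / 2)).
    by split; apply/nbhs_seminormP => //; exists F, (e / 2); split.
  move=> [x' y'] /= [Fx Fy]; apply: FA => p Fp /=.
  have [_ pD _] := sP _ (FP _ Fp).
  rewrite opprD addrACA (splitr e); apply: le_lt_trans (pD _ _) _.
  by rewrite ltrD ?Fx ?Fy.
move=> [a x] A /(nbhs_seminormP _ _ sP)[F [e [fF FP e0 FA]]].
have [M M0 FM] : exists2 M, 0 < M & forall p, F p -> p x <= M.
  move/finite_seqP: fF => [s sF]; rewrite sF.
  exists (1 + \sum_(p <- s) `|p x|); first by rewrite ltr_pwDl// sumr_ge0.
  move=> p /= ps; apply: (le_trans (ler_norm _)).
  by rewrite (big_rem _ ps) /= addrCA lerDl addr_ge0// sumr_ge0.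
(* For [b] within [d] of [a], [d <= 1] gives [real_norm b <= 1 + real_norm a], so the radius [r]
   keeps [b *: (y - x)] below [e / 2]; [d <= e / 2 / M] keeps [(b - a) *: x] at most [e / 2]. *)
pose d := Num.min 1 (e / 2 / M).
have d0 : 0 < d by rewrite lt_min ltr01 !divr_gt0.
have a0 : 0 <= real_norm (a : K) := real_norm_ge0 _.
pose r := e / 2 / (1 + real_norm (a : K)).
have r0 : 0 < r by rewrite !divr_gt0// ltr_pwDl.
exists ([set b : K | real_norm (b - a : K) < d], seminorm_ball F x r).
  split; first exact: nbhs_real_norm.
  by apply/nbhs_seminormP => //; exists F, r; split.
move=> [b y] /= [bad Fy]; apply: FA => p Fp /=.
have [p0 pD pZ] := sP _ (FP _ Fp).
rewrite (_ : b *: y - a *: x = b *: (y - x) + (b - a) *: x); last first.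
  by rewrite scalerBr scalerBl addrA subrK.
apply: le_lt_trans (pD _ _) _; rewrite !pZ (splitr e).
have bn : real_norm (b : K) <= 1 + real_norm (a : K).
  rewrite -[b in leLHS](subrK a) -[b - a]scale1r.
  apply: le_trans (real_norm_axpy _ _ _) _.
  rewrite -of_real1 real_norm_of_real normr1 mul1r lerD2r; apply/ltW.
  by apply: lt_le_trans bad _; rewrite ge_min lexx.
apply: ltr_leD.
  apply: (@le_lt_trans _ _ ((1 + real_norm (a : K)) * p (y - x))).
    by rewrite ler_wpM2r.
  by rewrite mulrC -ltr_pdivlMr ?ltr_pwDl//; exact: Fy.
apply: (@le_trans _ _ (e / 2 / M * M)); last by rewrite divfK ?gt_eqF.
apply: ler_pM => //; [exact: real_norm_ge0| |exact: FM].
by apply/ltW; apply: lt_le_trans bad _; rewrite ge_min lexx orbT.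
Qed.

(** Continuity of [p] at 0 on [D] for the topology of [Q]. With [D] the whole space it compares
    seminorm topologies; with [D] a norm-ball it describes the seminorms used for the mixed
    topology. *)
Definition subordinate (D : set X) Q p := forall e : R, 0 < e ->
  exists F (d : R), [/\ finite_set F, F `<=` Q, 0 < d &
    forall y, D y -> (forall q, F q -> q y < d) -> p y < e].

(** Finitely many estimates at 0 merge by a union of seminorms and a minimum of radii. Applied to
    [y - x] they hold around every [x]. *)
Lemma subordinate_ball (D : set X) Q (F : set (X -> R)) (e : R) :
  finite_set F -> 0 < e -> (forall p, F p -> subordinate D Q p) ->
  exists G (d : R), [/\ finite_set G, G `<=` Q, 0 < d &
    forall x y, D (y - x) -> seminorm_ball G x d y -> seminorm_ball F x e y].
Proof.
move=> /finite_seqP[s ->] e0; elim: s => [|p s IH] sub.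
  by exists set0, 1; split.
have [|G [d [fG GQ d0 GF]]] := IH.
  by move=> r rs; apply: sub; rewrite /= in_cons rs orbT.
have /(_ _ e0)[H [c [fH HQ c0 HF]]] := sub p (mem_head _ _).
exists (G `|` H), (Num.min d c); split.
- by rewrite finite_setU.
- by rewrite subUset.
- by rewrite lt_min d0.
- move=> x y Dxy GH r /=; rewrite in_cons => /predU1P[->|rs].
    apply: HF => // q Hq; have := GH q (or_intror Hq).
    by rewrite lt_min => /andP[].
  apply: (GF x) rs => // q Gq; have := GH q (or_introl Gq).
  by rewrite lt_min => /andP[].
Qed.

Lemma coarser_seminorm P Q : (forall p, P p -> subordinate setT Q p) ->
  coarser (seminorm_topology P) (seminorm_topology Q).
Proof.
move=> PQ U /= oU x /oU[F [e [fF FP e0 FU]]].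
have [|G [d [fG GQ d0 GF]]] := @subordinate_ball setT Q F e fF e0.
  by move=> p /FP; exact: PQ.
by exists G, d; split => // y Gy; apply: FU; exact: GF.
Qed.

Lemma dominated_subordinate (D : set X) Q p q : Q q -> (forall x, p x <= q x) ->
  subordinate D Q p.
Proof.
move=> Qq pq e e0; exists [set q], e; split => //; first by move=> _ ->.
by move=> y _ /(_ q erefl); exact: le_lt_trans.
Qed.

Lemma eq_seminorm_topology P Q :
  (forall p, P p -> exists2 q, Q q & forall x, p x <= q x) ->
  (forall q, Q q -> exists2 p, P p & forall x, q x <= p x) ->
  seminorm_topology P = seminorm_topology Q.
Proof.
move=> PQ QP; apply: topology_eq; apply/seteqP.
split; apply: coarser_seminorm => p.
  by move=> /PQ[q Qq pq]; exact: dominated_subordinate pq.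
by move=> /QP[q Qq pq]; exact: dominated_subordinate pq.
Qed.

(** If [x] and [y] cannot be separated, their [p]-balls of radius [e / 2] meet for every [e], so
    [p (x - y) = 0] for each [p]. *)
Lemma hausdorff_seminorm_topology P : (forall p, P p -> is_seminorm p) ->
  (forall x, (forall p, P p -> p x = 0) -> x = 0) ->
  hausdorff_space (topologized (seminorm_topology P)).
Proof.
move=> sP sep x y cl; apply: (@subr0_eq X); apply: sep => p Pp.
have [p0 _ _] := sP _ Pp; apply: le_anti; rewrite p0 andbT.
apply/ler_addgt0Pl => e e0; rewrite addr0.
have e20 : 0 < e / 2 by rewrite divr_gt0.
have nb z : nbhs (z : topologized (seminorm_topology P))
    (seminorm_ball [set p] z (e / 2)).
  apply/nbhs_seminormP => //; exists [set p], (e / 2); split => //.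
  by move=> _ ->.
have [z [/(_ p erefl) zx /(_ p erefl) zy]] := cl _ _ (nb x) (nb y).
apply: le_trans (seminorm_dist x z y (sP _ Pp)) _.
by rewrite (splitr e) (seminormB x z (sP _ Pp)) ltW// ltrD.
Qed.

End seminorm_theory.

(** * Minkowski functionals *)

Section minkowski_functional.
Context (R : realType) (k : scalars) (X : lmodType (scalar_field R k)).
Let K := scalar_field R k.
Context (W : set X).
Hypothesis W_balanced :
  forall (a : K) y, real_norm (a : K) <= 1 -> W y -> W (a *: y).
Hypothesis W_convex : forall (s : R) y z, 0 <= s <= 1 -> W y -> W z ->
  W (of_real k s *: y + of_real k (1 - s) *: z).
Hypothesis W_absorbing : forall y, exists2 t : R, 0 < t & W (of_real k t^-1 *: y).

Definition minkowski_functional (y : X) : R :=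
  inf [set t | 0 < t /\ W (of_real k t^-1 *: y)].

Let has_inf_dilations y : has_inf [set t | 0 < t /\ W (of_real k t^-1 *: y)].
Proof.
split; first by have [t] := W_absorbing y; exists t.
by exists 0 => t [/ltW].
Qed.

Lemma minkowski_functional_ge0 y : 0 <= minkowski_functional y.
Proof. by apply: lb_le_inf; [case: (has_inf_dilations y)|move=> t [/ltW]]. Qed.

Lemma minkowski_functional_le y t : 0 < t -> W (of_real k t^-1 *: y) ->
  minkowski_functional y <= t.
Proof. by move=> t0 Wy; apply: ge_inf; [case: (has_inf_dilations y)|]. Qed.

(** Some [s < t] has the dilation of [y] by [s^-1] in [W], and balancedness allows the further
    contraction by [s / t]. *)
Lemma minkowski_functional_lt y t : minkowski_functional y < t ->
  W (of_real k t^-1 *: y).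
Proof.
move=> /inf_lt[|s [s0 Wy] st]; first by case: (has_inf_dilations y).
have t0 : 0 < t by exact: lt_trans st.
rewrite (_ : t^-1 = s / t * s^-1); last by rewrite mulrAC divff ?gt_eqF// mul1r.
rewrite of_realM -scalerA; apply: W_balanced Wy.
rewrite real_norm_of_real ger0_norm ?divr_ge0 ?ltW//.
by rewrite ltr_pdivrMr// mul1r.
Qed.

Let minkowski_functionalZ_le (a : K) y : a != 0 ->
  minkowski_functional (a *: y) <= real_norm (a : K) * minkowski_functional y.
Proof.
move=> a0; have n0 : 0 < real_norm (a : K).
  rewrite lt_neqAle real_norm_ge0 andbT eq_sym; apply: contra_neq a0.
  exact: real_norm_eq0.
rewrite -ler_pdivrMl//; apply: lb_le_inf; first by case: (has_inf_dilations y).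
move=> t [t0 Wy]; rewrite ler_pdivrMl//; apply: minkowski_functional_le.
  by rewrite mulr_gt0.
(* What multiplies the dilation of [y] by [t^-1] is [a] divided by its real norm, a scalar of norm
   1. *)
rewrite scalerA invfM of_realM mulrAC -scalerA; apply: W_balanced Wy.
rewrite real_normM real_norm_of_real ger0_norm ?invr_ge0 ?(ltW n0)//.
by rewrite mulVf ?lexx ?lt0r_neq0.
Qed.

Lemma minkowski_functional_seminorm : is_seminorm minkowski_functional.
Proof.
apply: seminorm_of_le; first exact: minkowski_functional_ge0.
  move=> y z; apply/ler_addgt0Pr => e e0.
  pose t := minkowski_functional y + e / 2.
  pose s := minkowski_functional z + e / 2.
  have e20 : 0 < e / 2 by rewrite divr_gt0.
  have t0 : 0 < t by rewrite ltr_wpDl// minkowski_functional_ge0.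
  have s0 : 0 < s by rewrite ltr_wpDl// minkowski_functional_ge0.
  have -> : minkowski_functional y + minkowski_functional z + e = t + s.
    by rewrite /t /s addrACA -splitr.
  have ts0 : 0 < t + s by rewrite addr_gt0.
  apply: minkowski_functional_le => //.
  (* With weights [t / (t + s)] and [s / (t + s)], the convex combination of the two dilated points
     is [y + z] dilated by [(t + s)^-1]. *)
  have := @W_convex (t / (t + s)) (of_real k t^-1 *: y) (of_real k s^-1 *: z).
  rewrite (_ : 1 - _ = s / (t + s)); last first.
    apply: (mulIf (lt0r_neq0 ts0)).
    by rewrite mulrBl !divfK ?gt_eqF// mul1r addrAC subrr add0r.
  rewrite !scalerA -!of_realM 2!(mulrAC _ (t + s)^-1) !divff ?gt_eqF//.
  rewrite !mul1r -scalerDr; apply.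
  - by rewrite divr_ge0 ?(ltW t0) ?(ltW ts0)//= ler_pdivrMr// mul1r lerDl ltW.
  - by apply: minkowski_functional_lt; rewrite ltrDl.
  - by apply: minkowski_functional_lt; rewrite ltrDl.
move=> a y; have [->|a0] := eqVneq a 0.
  rewrite scale0r real_norm0 mul0r; apply/ler_addgt0Pr => e e0.
  rewrite add0r; apply: minkowski_functional_le => //.
  (* Absorption of 0 puts 0 itself in [W], so every positive [e] is an admissible dilation. *)
  have [t t0 Wy] := W_absorbing 0.
  by rewrite scaler0; move: Wy; rewrite scaler0.
exact: minkowski_functionalZ_le.
Qed.

End minkowski_functional.

(** * C-sequentiality of mixed topologies *)

Section C_sequentiality.
Context (R : realType) (k : scalars) (X : lmodType (scalar_field R k)).
Let K := scalar_field R k.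
Context (N : X -> R) (P : set (X -> R)).
Hypotheses (sN : is_seminorm N) (sP : forall p, P p -> is_seminorm p)
  (PN : forall p, P p -> forall x, p x <= N x).

Let tau := seminorm_topology P.
Let gam := mixed_topology N tau.

Let lin_tau : linear_topology tau.
Proof. exact: linear_seminorm_topology. Qed.

Let tauN : coarser tau (norm_topology N).
Proof.
by apply: coarser_seminorm => p /PN; exact: dominated_subordinate.
Qed.

Definition ball_continuous_seminorms : set (X -> R) :=
  [set p | is_seminorm p /\ forall M, subordinate [set x | N x <= M] P p].

Let bcP := ball_continuous_seminorms.

(** Every [p] in [P] is ball-continuous, so this topology is finer than [tau]; on a norm-bounded set
    it adds nothing, because differences of points there stay in one ball. *)
Lemma mixing_ball_continuous : mixing_topology N tau (seminorm_topology bcP).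
Proof.
have taut : coarser tau (seminorm_topology bcP).
  apply: coarser_seminorm => p Pp; apply: (@dominated_subordinate _ _ _ _ _ _ p) => //.
  by split; [exact: sP|move=> M; apply: dominated_subordinate Pp _].
split => //.
- by apply: linear_seminorm_topology => p [].
- apply: coarser_seminorm => p [_ /(_ 1) pP] e /pP[F [d [fF FP d0 Fp]]].
  (* The bound 1 makes the estimate on the unit ball applicable; the bound [d] controls each [q] in
     [F], since [q <= N]. *)
  exists [set N], (Num.min 1 d); split; rewrite ?lt_min ?ltr01//.
  move=> y _ /(_ N erefl); rewrite lt_min => /andP[y1 yd]; apply: Fp.
    exact: ltW.
  by move=> q /FP/PN qN; exact: le_lt_trans (qN y) yd.
- move=> B [M BM]; apply/seteqP; split => _ [U oU <-]; last first.
    by exists U => //; exact: taut.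
  exists (\bigcup_(V in [set V | is_open tau V /\ V `&` B `<=` U]) V).
    by apply: is_open_bigU => V [].
  apply/seteqP; split => x [].
    by move=> [V [_ VU] Vx] Bx; split => //; exact: VU.
  move=> Ux Bx; split=> //.
  have [F [e [fF FP e0 FU]]] := oU _ Ux.
  (* For [y] in [B] the difference [y - x] has norm at most [M + N x], so continuity on that ball
     suffices. *)
  have [|G [d [fG GP d0 GF]]] :=
    @subordinate_ball _ _ _ [set y | N y <= M + N x] P F e fF e0.
    by move=> p /FP [].
  exists (seminorm_ball G x d); last first.
    by move=> p /GP/sP/seminorm0; rewrite subrr => ->.
  split; first exact: seminorm_ball_open.
  move=> y [Gy By]; apply: FU; apply: GF Gy => /=.
  have [_ ND _] := sN; apply: le_trans (ND _ _) _.
  by rewrite seminormN// lerD2r BM.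
Qed.

(** The points [x + y n] and [x] stay in the ball of radius [M + N x], on which [gam] and [tau] have
    the same traces, so convergence for [tau] is enough. *)
Lemma bounded_cvg_mixed (x : X) (y : nat -> X) (M : R) :
  (forall n, N (y n) <= M) ->
  (forall p e, P p -> 0 < e -> \forall n \near \oo, p (y n) < e) ->
  (fun n => x + y n : topologized gam) @ \oo --> (x : topologized gam).
Proof.
move=> yM yP A; rewrite /= [X in X A -> _]nbhsE => -[Q [oQ Qx] QA].
have [[_ _ _ trB] _] := mixed_topologyP lin_tau tauN.
have [_ ND _] := sN.
pose B := [set z | N z <= M + N x].
have trE : traces gam B = traces tau B by apply: trB; exists (M + N x).
have : traces gam B (Q `&` B) by exists Q.
rewrite trE => -[V oV VQ].
have Vx : V x.
  have : (Q `&` B) x.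
    split => //; rewrite /B /=.
    by rewrite lerDr (le_trans _ (yM 0%N))//; case: sN.
  by rewrite -VQ => -[].
have [F [e [fF FP e0 FV]]] := oV x Vx.
have : \forall n \near \oo, forall p, F p -> p (y n) < e.
  move: FP; have /finite_seqP[s ->] := fF; elim: s {fF FV} => [|p s IH] sub.
    by near=> n.
  have /IH : [set` s] `<=` P.
    by move=> r rs; apply: sub; rewrite /= in_cons rs orbT.
  have /yP/(_ e0) := sub p (mem_head _ _).
  apply: filterS2 => n pn sn r /=; rewrite in_cons => /predU1P[->//|].
  exact: sn.
apply: filterS => n Fn; apply: QA.
suff : (V `&` B) (x + y n) by rewrite VQ => -[].
split; first by apply: FV => p /Fn; rewrite addrAC subrr add0r.
by rewrite /B /= addrC (le_trans (ND _ _))// lerD2r.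
Unshelve. all: by end_near.
Qed.

(** The sequence [r] expresses first countability: since each [p] is below [r n] for all large [n],
    the bounds [r n (y n) < 1 / (n + 1)] make [y] null for every [p]. *)
Lemma C_sequential_of_cofinal (r : nat -> X -> R) :
  (forall n, P (r n)) ->
  (forall p, P p -> exists n0, forall n, (n0 <= n)%N -> forall x, p x <= r n x) ->
  C_sequential N tau.
Proof.
move=> Pr rP U cU sU.
(* The mixed topology is finer than each mixing topology, so openness for one of them suffices. *)
suff oU : seminorm_open bcP U by move=> t mt; exact: mt mixing_ball_continuous _ oU.
have convU (s : R) y z : 0 <= s <= 1 -> U y -> U z ->
    U (of_real k s *: y + of_real k (1 - s) *: z).
  move=> /andP[s0 s1] Uy Uz.
  have := cU y z (Itv01 (of_real_ge0 k s0) (of_real_le1 k s1)).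
  rewrite !inE => /(_ Uy Uz).
  by rewrite of_realB of_real1.
move=> x Ux; have [N0 ND NZ] := sN.
pose W := [set y | forall a : K, real_norm (a : K) <= 1 -> U (x + a *: y)].
(* A failure of the claim yields a bounded sequence outside [U - x] which is
null for [tau], hence for the mixed topology. *)
have nbhsW M : exists n (d : R), 0 < d /\
    forall y, N y <= M -> r n y < d -> W y.
  (* Both bounds on [y] persist under scalars of norm at most 1, so an inclusion in [U - x] passes
     to its balanced core. *)
  suff [n [d [d0 H]]] : exists n (d : R), 0 < d /\
      forall y, N y <= M -> r n y < d -> U (x + y).
    exists n, d; split => // y yM yd a a1; have [r0 _ rZ] := sP (Pr n).
    apply: H; rewrite ?NZ ?rZ.
      by apply: le_trans yM; rewrite ler_piMl.
    by apply: le_lt_trans yd; rewrite ler_piMl.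
  apply: contrapT => /forallNP H.
  have bad n : exists y, [/\ N y <= M, r n y < n.+1%:R^-1 & ~ U (x + y)].
    apply: contrapT => /forallNP Hn; apply: (H n).
    exists n.+1%:R^-1; split; first by rewrite invr_gt0.
    by move=> y yM yr; apply: contrapT => nU; apply: (Hn y).
  have [y yP] := choice bad.
  have /(sU _ _ Ux) : (fun n => x + y n : topologized gam) @ \oo -->
      (x : topologized gam).
    apply: (@bounded_cvg_mixed x y M) => [n|p e Pp e0]; first by case: (yP n).
    have [n0 pr] := rP p Pp.
    near=> n; have [_ yn _] := yP n.
    apply: le_lt_trans (pr n _ _) _; first by near: n; exists n0.
    apply: lt_trans yn _; near: n; exact: near_infty_natSinv_lt (PosNum e0).
  move=> [m _ /(_ m (leqnn m))]; by have [] := yP m.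
have Wbal (a : K) y : real_norm (a : K) <= 1 -> W y -> W (a *: y).
  move=> a1 Wy b b1; rewrite scalerA; apply: Wy.
  by rewrite real_normM mulr_ile1// real_norm_ge0.
have Wconv (s : R) y z : 0 <= s <= 1 -> W y -> W z ->
    W (of_real k s *: y + of_real k (1 - s) *: z).
  move=> s01 Wy Wz a a1.
  rewrite (_ : x + _ = of_real k s *: (x + a *: y) +
      of_real k (1 - s) *: (x + a *: z)).
    by apply: convU => //; [exact: Wy|exact: Wz].
  rewrite !scalerDr addrACA -scalerDl -of_realD subrKC of_real1 scale1r.
  by congr (_ + (_ + _)); rewrite !scalerA mulrC.
have Wabs y : exists2 t : R, 0 < t & W (of_real k t^-1 *: y).
  have [n [d [d0 H]]] := nbhsW 1.
  (* The first factor brings the norm of the dilated [y] to at most 1; the second brings it below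
     [d], and [r n <= N]. *)
  pose t := (N y + 1) * Num.max 1 d^-1 ; have c0 : 0 < N y + 1 by rewrite ltr_wpDl.
  have m0 : 0 < Num.max 1 d^-1 by rewrite lt_max ltr01.
  have t0 : 0 < t by rewrite mulr_gt0.
  have Nt : N (of_real k t^-1 *: y) = t^-1 * N y.
    by rewrite NZ real_norm_of_real ger0_norm// invr_ge0 ltW.
  exists t => //; apply: H.
    rewrite Nt mulrC ler_pdivrMr// mul1r /t.
    rewrite -[leLHS]mulr1; apply: ler_pM => //; first by rewrite lerDl.
    by rewrite le_max lexx.
  apply: le_lt_trans (PN (Pr n) _) _; rewrite Nt mulrC ltr_pdivrMr// /t.
  apply: (@lt_le_trans _ _ (N y + 1)); first by rewrite ltrDl.
  rewrite mulrCA ler_peMr ?(ltW c0)//.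
  by rewrite -ler_pdivrMl// mulr1 le_max lexx orbT.
exists [set minkowski_functional W], 1; split => //.
- move=> _ ->; split; first exact: minkowski_functional_seminorm.
  move=> M e e0.
  have e20 : 0 < e / 2 by rewrite divr_gt0.
  (* The claim is applied to [y] dilated by [(e / 2)^-1], hence the scaled radius. It yields a
     functional of at most [e / 2], which is strictly below [e]. *)
  have [n [d [d0 H]]] := nbhsW ((e / 2)^-1 * M).
  have [_ _ rZ] := sP (Pr n).
  exists [set r n], (e / 2 * d); split => //.
  + by move=> _ ->.
  + by rewrite mulr_gt0.
  + move=> y yM /(_ _ erefl) yd.
    have e1 : 0 <= (e / 2)^-1 by rewrite invr_ge0 ltW.
    apply: (@le_lt_trans _ _ (e / 2)); last first.
      by rewrite ltr_pdivrMr// ltr_pMr// ltr1n.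
    apply: minkowski_functional_le => //; apply: H.
      by rewrite NZ real_norm_of_real ger0_norm// ler_wpM2l.
    by rewrite rZ real_norm_of_real ger0_norm// ltr_pdivrMl.
(* A functional below 1 puts [y - x] in [W]; the scalar 1 in the definition of [W] then gives
   [U y]. *)
- move=> y /(_ _ erefl) /(minkowski_functional_lt Wbal Wabs).
  rewrite invr1 => /(_ 1); rewrite of_real1 !scale1r subrKC; apply.
  by rewrite -(of_real1 R k) real_norm_of_real normr1.
Unshelve. all: by end_near.
Qed.

End C_sequentiality.

(** * Weights vanishing at infinity *)

(* The complements in [K] of the sets satisfying [Q] would form a proper filter
on [K] without cluster point. *)
Lemma compact_ind (T : topologicalType) (Q : set T -> Prop) (K : set T) :
  Q set0 -> (forall A B, A `<=` B -> Q B -> Q A) ->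
  (forall A B, Q A -> Q B -> Q (A `|` B)) ->
  (forall x, K x -> exists2 U, nbhs x U & Q U) ->
  compact K -> Q K.
Proof.
move=> Q0 QS QU Qloc cK; apply: contrapT => nQK.
pose F : set_system T := [set A | Q (K `\` A)].
have FF : ProperFilter F.
  split; first by rewrite /F /= setD0.
  split; first by rewrite /F /= setDT.
    by move=> A B FA FB; rewrite /F /= setDIr; exact: QU.
  by move=> A B AB; apply: QS; exact: setDS.
have FK : F K by rewrite /F /= setDv.
have [x [Kx clx]] := cK F FF FK; have [U xU QUU] := Qloc x Kx.
have FU : F (~` U) by apply: QS QUU; rewrite setDE setCK; exact: subIsetr.
by have [z []] := clx _ _ FU xU.
Qed.

(** * Null sequences and suprema of functions bounded by them *)

Section null_sequence_theory.
Context (R : realType) (a : nat -> R).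
Hypothesis null_a : null_sequence a.

Lemma null_sequence_lt (e : R) : 0 < e ->
  exists n0, forall n, (n0 <= n)%N -> a n < e.
Proof.
case: null_a => a0 /cvgr0Pnorm_lt/[apply] -[n0 _ H]; exists n0 => n /H /=.
by rewrite ger0_norm.
Qed.

Lemma null_sequence_ub : exists2 M, 0 <= M & forall n, a n <= M.
Proof.
have [a0 ca] := null_a; have [M Ma] := cvg_has_ub (cvgP _ ca).
exists `|M| => // n; apply: le_trans (ler_norm M).
by rewrite -(ger0_norm (a0 n)); apply: Ma; exists n.
Qed.

End null_sequence_theory.

Section null_suprema.
Context (R : realType) (L : topologicalType) (a : nat -> R) (g : nat -> L -> R).
Hypotheses (null_a : null_sequence a) (ga : forall n x, 0 <= g n x <= a n).

Definition null_sup (x : L) : R := sup (range (g^~ x)).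

Let has_ub x : has_ubound (range (g^~ x)).
Proof.
have [M _ aM] := null_sequence_ub null_a.
by exists M => _ [n _ <-]; apply: le_trans (aM n); case/andP: (ga n x).
Qed.

Lemma null_sup_ge n x : g n x <= null_sup x.
Proof. by apply: ub_le_sup; [exact: has_ub|exists n]. Qed.

Lemma null_sup_ge0 x : 0 <= null_sup x.
Proof. by apply: le_trans (null_sup_ge 0%N x); case/andP: (ga 0%N x). Qed.

Lemma null_sup_gt c x : c < null_sup x -> exists n, c < g n x.
Proof. by move=> /sup_gt[|_ [n _ <-] ?]; [exists (g 0%N x), 0%N|exists n]. Qed.

Lemma null_sup_le c x : (forall n, g n x <= c) -> null_sup x <= c.
Proof.
by move=> gc; apply: ge_sup => [|_ [n _ <-]//]; exists (g 0%N x), 0%N.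
Qed.

(** From [n0] on the functions are below [e] everywhere; the finitely many others are controlled on
    a common neighbourhood. *)
Lemma null_sup_usc :
  (forall n, upper_semicontinuous (g n)) -> upper_semicontinuous null_sup.
Proof.
move=> gusc x c wc; pose e := (c - null_sup x) / 2.
have e0 : 0 < e by rewrite divr_gt0// subr_gt0.
have ec : null_sup x + e < c by rewrite /e; lra.
have [n0 an] := null_sequence_lt null_a e0.
have : \forall y \near x, forall n, (n < n0)%N -> g n y < null_sup x + e.
  elim: n0 {an} => [|n0 IH]; first by near=> y.
  have gx : g n0 x < null_sup x + e by rewrite ltr_pwDr// null_sup_ge.
  apply: filterS2 (gusc n0 x _ gx) IH => y gy IH n.
  by rewrite ltnS leq_eqVlt => /predU1P[->//|]; exact: IH.
apply: filterS => y Hy; apply: le_lt_trans ec; apply: null_sup_le => n.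
have [/Hy/ltW//|/an/ltW ae] := ltnP n n0.
by case/andP: (ga n y) => _ /le_trans; apply; rewrite ler_wpDl// null_sup_ge0.
Unshelve. all: by end_near.
Qed.

(** The upper estimate is semicontinuity; for the lower one a single [g n] that nearly attains the
    supremum at [x] is enough. *)
Lemma continuous_null_sup : (forall n, continuous (g n)) -> continuous null_sup.
Proof.
move=> gc x; apply/cvgrPdist_lt => e e0.
have yub : \forall y \near x, null_sup y < null_sup x + e.
  apply: null_sup_usc; last by rewrite ltrDl.
  by move=> n z c zc; exact: (cvgr_lt _ (gc n z) _ zc).
have [n gn] : exists n, null_sup x - e < g n x.
  by apply: null_sup_gt; rewrite gtrBl.
have ylb : \forall y \near x, null_sup x - e < g n y.
  exact: (cvgr_gt _ (gc n x) _ gn).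
apply: filterS2 yub ylb => y yub ylb; rewrite distrC ltr_distl yub andbT.
exact: lt_le_trans (null_sup_ge n y).
Qed.

(** A superlevel set is closed by semicontinuity. A supremum of at least [e] forces some [g n] above
    [e / 2], hence [n < n0], so the set lies in a finite union of the [K n]. *)
Lemma null_sup_vanishes (K : nat -> set L) :
  (forall n, compact (K n)) -> (forall n x, g n x != 0 -> K n x) ->
  (forall n, upper_semicontinuous (g n)) -> vanishes_at_infinity null_sup.
Proof.
move=> cK gK gusc e e0.
have e20 : 0 < e / 2 by rewrite divr_gt0.
have [n0 an] := null_sequence_lt null_a e20.
apply: (@subclosed_compact _ _ (\big[setU/set0]_(n < n0) K n)).
- rewrite (_ : [set x | _] = ~` [set x | null_sup x < e]); last first.
    by apply/seteqP; split => x /=; rewrite leNgt => /negP.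
  apply: open_closedC; rewrite openE => x /= xe.
  exact: null_sup_usc.
- exact: bigsetU_compact.
- move=> x /= xe; have [n gn] : exists n, e / 2 < g n x.
    by apply: null_sup_gt; apply: lt_le_trans xe; rewrite ltr_pdivrMr// ltr_pMr// ltr1n.
  have [nn|/an] := ltnP n n0.
    rewrite -bigcup_mkord; exists n => //; apply: gK.
    by rewrite gt_eqF// (lt_trans e20).
  by case/andP: (ga n x) => _ /(lt_le_trans gn) /lt_trans/[apply]; rewrite ltxx.
Qed.

End null_suprema.

(** * Weights dominating null sequences on compact sets *)

Section weights.
Context (R : realType) (L : topologicalType).
Hypothesis hL : hausdorff_space L.

(** Semicontinuity bounds [w] locally, hence on the compact set where [1 <= w]; elsewhere 1 is a
    bound. *)
Lemma usc_weights_bounded : usc_weights R L `<=` bounded_weights R L.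
Proof.
move=> w [w0 wusc wv]; split=> //.
have [M MK] : has_ubound (w @` [set x | 1 <= w x]).
  apply: (@compact_ind _ (fun A => has_ubound (w @` A))); last exact: wv.
  - by rewrite image_set0; exists 0.
  - move=> A B AB [M BM]; exists M => _ [x Ax <-]; apply: BM.
    by exists x => //; exact: AB.
  - move=> A B [M AM] [M' BM]; exists (Num.max M M') => _ [x [Ax|Bx] <-].
      by rewrite le_max AM//; exists x.
    by rewrite le_max (BM (w x)) ?orbT//; exists x.
  - move=> x _; exists [set y | w y < w x + 1]; first by apply: wusc; rewrite ltrDl.
    by exists (w x + 1) => _ [y /ltW yx <-].
exists (Num.max 1 M) => _ [x _ <-]; rewrite le_max.
by have [//|/ltW w1] := leP (w x) 1; apply: MK; exists x.
Qed.

Lemma usc_weight_of_compacts (A : nat -> set L) (a : nat -> R) :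
  (forall n, compact (A n)) -> null_sequence a ->
  exists2 w, usc_weights R L w & forall n x, A n x -> a n <= w x.
Proof.
move=> cA na; have [a0 _] := na; pose g n x := a n * \1_(A n) x.
have ga n x : 0 <= g n x <= a n.
  by rewrite /g indicE; case: (x \in A n); rewrite ?mulr1 ?mulr0 ?lexx ?a0.
have gusc n : upper_semicontinuous (g n).
  move=> x c; rewrite /g indicE; have [xA|xA] := boolP (x \in A n).
    rewrite mulr1 => ac; near=> y; apply: le_lt_trans ac.
    by case/andP: (ga n y).
  (* Compact sets are closed by the Hausdorff property, so the indicator vanishes near a point
     outside [A n]. *)
  rewrite mulr0 => c0; have : nbhs x (~` A n).
    apply: open_nbhs_nbhs; split; last by move/mem_set; exact/negP.
    by apply: closed_openC; exact: compact_closed.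
  by apply: filterS => y yA; rewrite indicE memNset// mulr0.
exists (null_sup g).
  split; first exact: (null_sup_ge0 na ga).
    exact: (null_sup_usc na ga).
  apply: (null_sup_vanishes na ga cA) => // n x; apply: contra_neqP => nA.
  by rewrite /g indicE memNset// mulr0.
move=> n x nA; apply: le_trans (null_sup_ge na ga n x).
by rewrite /g indicE mem_set// mulr1.
Unshelve. all: by end_near.
Qed.

Hypotheses (lcL : locally_compact [set: L]) (crL : completely_regular_space L).

Lemma compact_bump (A : set L) : compact A -> exists h : L -> R,
  [/\ continuous h, forall x, 0 <= h x <= 1, forall x, A x -> h x = 1 &
      exists2 B, compact B & forall x, h x != 0 -> B x].
Proof.
(* The condition [1 <= h] on [A] survives sums, which the induction over compact sets requires;
   truncation at 1 then gives the exact value. *)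
move=> cA; suff [h [hc h0 h1 [B cB hB]]] : exists h : L -> R,
  [/\ continuous h, forall x, 0 <= h x, forall x, A x -> 1 <= h x &
      exists2 B, compact B & forall x, h x != 0 -> B x].
  exists (h \min cst 1); split.
  - by move=> x; apply: continuous_min; [exact: hc|exact: cst_continuous].
  - by move=> x /=; rewrite le_min h0 ler01 ge_min lexx orbT.
  - by move=> x /h1 hx /=; apply/min_idPr.
  - exists B => // x /=; apply: contra_neqP => nB.
    have -> : h x = 0 by apply: contra_notP nB => /eqP; exact: hB.
    by apply/min_idPl.
pose Q A := exists h : L -> R,
  [/\ continuous h, forall x, 0 <= h x, forall x, A x -> 1 <= h x &
      exists2 B, compact B & forall x, h x != 0 -> B x].
apply: (@compact_ind _ Q) cA.
- exists (cst 0); split => //; first exact: cst_continuous.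
  by exists set0; [exact: compact0|move=> x; rewrite /cst eqxx].
- move=> B C BC [h [hc h0 h1 hK]]; exists h; split => // x /BC; exact: h1.
- move=> B C [h [hc h0 h1 [K cK hK]]] [f [fc f0 f1 [M cM fM]]].
  exists (h \+ f); split.
  + by move=> x; apply: cvgD; [exact: hc|exact: fc].
  + by move=> x; exact: addr_ge0.
  + by move=> x [/h1|/f1] ?; [rewrite ler_wpDr|rewrite ler_wpDl].
  + exists (K `|` M); first exact: compactU.
    move=> x; apply: contra_neqP => /not_orP[nK nM] /=.
    have -> : h x = 0 by apply: contra_notP nK => /eqP; exact: hK.
    have -> : f x = 0 by apply: contra_notP nM => /eqP; exact: fM.
    by rewrite addr0.
- move=> x _; have [K xK [cK _]] := lcL (I : setT x).
  have {}xK : nbhs x K by move: xK; rewrite /within /=; apply: filterS => y; exact.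
  have : uniform_separator [set x] (~` K°).
    apply: crL; first by apply: open_closedC; exact: open_interior.
    by move=> /(_ xK).
  move=> /(@uniform_separatorP _ R)[f [fc f01 fx fK]].
  have fx0 : f x = 0 by apply: fx; exists x.
  (* On this neighbourhood [2 * (1 - f y)] is at least 1, and it vanishes off [K], where [f] is
     1. *)
  exists [set y | f y < 2^-1].
    by apply: (cvgr_lt _ (fc x)); rewrite fx0 invr_gt0.
  exists (fun y => 2 * (1 - f y)); split.
  + move=> y; apply: cvgM; first exact: cvg_cst.
    by apply: cvgB; [exact: cvg_cst|exact: fc].
  + move=> y; have /f01 := imageT f y; rewrite /= in_itv /= => /andP[_ f1].
    by rewrite mulr_ge0// subr_ge0.
  + by move=> y /= fy; lra.
  + exists K => // y; apply: contra_neqP => nK.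
    rewrite (_ : f y = 1) ?subrr ?mulr0//; apply: fK; exists y => //.
    by move=> /interior_subset.
Qed.

Lemma continuous_weight_of_compacts (A : nat -> set L) (a : nat -> R) :
  (forall n, compact (A n)) -> null_sequence a ->
  exists2 w, continuous_weights R L w & forall n x, A n x -> a n <= w x.
Proof.
move=> cA na; have [a0 _] := na.
have /choice[h hP] n := compact_bump (cA n).
have /choice[B BP] n : exists B, compact B /\ forall x, h n x != 0 -> B x.
  by have [_ _ _ [B cB hB]] := hP n; exists B.
pose g n x := a n * h n x.
have ga n x : 0 <= g n x <= a n.
  have [_ /(_ x)/andP[h0 h1] _ _] := hP n.
  by rewrite mulr_ge0//= ler_piMr.
have gc n : continuous (g n).
  move=> x; apply: cvgM; first exact: cvg_cst.
  by have [hc _ _ _] := hP n; exact: hc.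
exists (null_sup g).
  split; [exact: (null_sup_ge0 na ga)|exact: (continuous_null_sup na ga)|].
  apply: (null_sup_vanishes na ga (fun n => (BP n).1)).
    move=> n x; apply: contra_neqP => nB.
    have hx0 : h n x = 0 by apply: contra_notP nB => /eqP; apply: (BP n).2.
    by rewrite /g hx0 mulr0.
  by move=> n x c xc; exact: (cvgr_lt _ (gc n x) _ xc).
move=> n x nA; apply: le_trans (null_sup_ge na ga n x).
by have [_ _ /(_ x nA) h1 _] := hP n; rewrite /g h1 mulr1.
Qed.

End weights.

Lemma continuous_weights_usc (R : realType) (L : topologicalType) :
  continuous_weights R L `<=` usc_weights R L.
Proof.
move=> w [w0 wc wv]; split => // x c xc; exact: (cvgr_lt _ (wc x) _ xc).
Qed.

(** * Weighted spaces *)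

(** The sign of [c] settles the empty set, whose supremum is 0. *)
Lemma sup_le_ge0 (R : realType) (A : set R) (c : R) :
  0 <= c -> (forall t, A t -> t <= c) -> sup A <= c.
Proof.
move=> c0 Ac; have [->|A0] := eqVneq A set0; first by rewrite sup0.
by apply: ge_sup => //; exact/set0P.
Qed.

(** Flattens finite lists of lengths [s n], with weight [a n] on the entries of the [n]-th, into a
    single weighted sequence. *)
Lemma null_sequence_pairs (R : realType) (a : nat -> R) (s : nat -> nat) :
  null_sequence a -> exists (e : nat -> nat * nat) (b : nat -> R),
    null_sequence b /\
    forall n i, (i < s n)%N -> exists m, e m = (n, i) /\ b m = a n.
Proof.
move=> na; have [a0 _] := na.
(* An index that encodes no pair gets a dummy pair here, and weight 0 in [b], as does a pair out of
   range. *)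
pose e m : nat * nat := odflt (0, 0)%N (pickle_inv m).
pose b m := if pickle_inv m is Some (n, i) then
  if (i < s n)%N then a n else 0 else 0.
exists e, b; split; last first.
  by move=> n i si; exists (pickle (n, i)); rewrite /e /b pickleK_inv si.
have b0 m : 0 <= b m.
  by rewrite /b; case: pickle_inv => [[n i]|//]; case: ifP.
split => //; apply/cvgr0Pnorm_lt => d d0.
have [n0 an] := null_sequence_lt na d0.
(* Past the codes of all pairs in range with [n < n0], a weight is 0 or some [a n] with
   [n0 <= n]. *)
exists (\max_(n < n0) \max_(i < s n) pickle (n : nat, i : nat)).+1 => // m /= mlt.
rewrite ger0_norm// /b; case mE : (pickle_inv m) => [[n i]|//].
case: ifP => // si; have [nn|/an //] := ltnP n n0.
have pm : pickle (n, i) = m by have := @pickle_invK (nat * nat)%type m; rewrite mE.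
exfalso; move: mlt; rewrite -pm ltnNge => /negP; apply.
apply: leq_trans (leq_bigmax (Ordinal nn)) => /=.
exact: (leq_bigmax (Ordinal si)).
Qed.

(* Off its zeros, [w] is comparable to the weights [M / (n + 1)] on the compact
shells [M / (n + 2) <= w <= M / (n + 1)]. *)
Lemma bounded_weight_exhaustion (R : realType) (L : topologicalType) (w : L -> R) :
  bounded_weights R L w -> exists (A : nat -> set L) (a : nat -> R),
    [/\ forall n, compact (A n), null_sequence a &
        forall x, w x != 0 -> exists2 n, A n x & w x <= a n].
Proof.
move=> [w0 [M wM] wv]; pose c := Num.max 1 M.
have c0 : 0 < c by rewrite lt_max ltr01.
exists (fun n => [set x | c / n.+2%:R <= w x]), (fun n => c / n.+1%:R); split.
- by move=> n; apply: wv; rewrite divr_gt0.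
- split; first by move=> n; rewrite divr_ge0// ltW.
  rewrite -[X in _ --> X](mulr0 c); apply: cvgM; first exact: cvg_cst.
  exact: cvg_harmonic.
- move=> x wx; have {}wx : 0 < w x by rewrite lt_neqAle eq_sym wx w0.
  have ex : exists n, c / n.+2%:R <= w x.
    have [n0 _ /(_ n0 (leqnn _)) /= H] :=
      near_infty_natSinv_lt (PosNum (divr_gt0 wx c0)).
    exists n0; rewrite mulrC -ler_pdivlMr//; apply: le_trans (ltW H).
    by rewrite lef_pV2 ?posrE// ler_nat.
  (* The predecessor of the least such [n] fails the test, which bounds [w x] by [c / n.+1]; for
     [n = 0] that bound is [w x <= c]. *)
  have [n wn nmin] := ex_minnP ex; exists n => //.
  case: n wn nmin => [_ _|n _ nmin].
    by rewrite divr1 le_max (wM (w x)) ?orbT//; exists x.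
  by rewrite leNgt; apply/negP => /ltW/nmin; rewrite ltnn.
Qed.

(** * Bounds for the seminorms of a weighted space *)

Section weighted_space_theory.
Context (R : realType) (k : scalars) (Omega Lambda : Type)
  (v : Lambda -> {posnum R}) (E : normedModType (scalar_field R k))
  (G : submodClosed (Omega -> E)) (q : submodule_of G -> R)
  (T : {linear submodule_of G -> (Lambda -> E)}).
Let K := scalar_field R k.
Hypothesis q_seminorm : is_seminorm q.

Local Notation V := (weighted_space v T).
Local Notation val_at f x := (weighted_value v T (val f) x).
Implicit Types (f g : V) (A B : set Lambda) (a : nat -> R) (S : set (set Lambda)).

Let N : V -> R := weighted_norm q.

Let q_ge0 f : 0 <= q (val f). Proof. by case: q_seminorm. Qed.

Let val_at_ge0 f x : 0 <= val_at f x.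
Proof. by rewrite mulr_ge0// real_norm_ge0. Qed.

Let has_ubound_val f A : has_ubound [set val_at f x | x in A].
Proof.
have /asboolP[M fM] : finite_weighted_sup v T (val f) by exact: (valP f).
by exists M => _ [x _ <-]; apply: fM; exists x.
Qed.

Lemma weighted_seminorm_ge A f x : A x ->
  q (val f) + val_at f x <= weighted_seminorm q A f.
Proof.
move=> Ax; rewrite lerD2l; apply: ub_le_sup; first exact: has_ubound_val.
by exists x.
Qed.

Lemma weighted_seminorm_ge_q A f : q (val f) <= weighted_seminorm q A f.
Proof.
rewrite /weighted_seminorm lerDl.
have [->|/set0P[_ [x Ax _]]] := eqVneq [set val_at f x | x in A] set0.
  by rewrite sup0.
apply: le_trans (val_at_ge0 f x) _.
by apply: ub_le_sup; [exact: has_ubound_val|exists x].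
Qed.

(** The separate bound on [q] covers an empty [A], where the seminorm reduces to [q]. *)
Lemma weighted_seminorm_le A f c : q (val f) <= c ->
  (forall x, A x -> q (val f) + val_at f x <= c) ->
  weighted_seminorm q A f <= c.
Proof.
move=> qc fc; rewrite /weighted_seminorm -lerBrDl; apply: sup_le_ge0.
  by rewrite subr_ge0.
by move=> _ [x Ax <-]; rewrite lerBrDl; exact: fc.
Qed.

Lemma weighted_seminorm_ge0 A f : 0 <= weighted_seminorm q A f.
Proof. exact: le_trans (weighted_seminorm_ge_q A f). Qed.

Lemma weighted_seminorm_mono A B f : A `<=` B ->
  weighted_seminorm q A f <= weighted_seminorm q B f.
Proof.
move=> AB; apply: weighted_seminorm_le; first exact: weighted_seminorm_ge_q.
by move=> x /AB; exact: weighted_seminorm_ge.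
Qed.

Lemma weighted_seminorm_mul_le A f (b c : R) : 0 <= b -> A !=set0 ->
  (forall x, A x -> (q (val f) + val_at f x) * b <= c) ->
  weighted_seminorm q A f * b <= c.
Proof.
rewrite le_eqVlt => /predU1P[<- [x Ax] /(_ x Ax)|b0 [y Ay] fc].
  by rewrite !mulr0.
rewrite -ler_pdivlMr//; apply: weighted_seminorm_le => [|x Ax].
  apply: (@le_trans _ _ (q (val f) + val_at f y)); first by rewrite lerDl.
  by rewrite ler_pdivlMr// fc.
by rewrite ler_pdivlMr// fc.
Qed.

Lemma weighted_seminorm_seminorm A : is_seminorm (weighted_seminorm q A : V -> R).
Proof.
have [_ qD qZ] := q_seminorm.
apply: seminorm_of_le => [f|f g|b f]; first exact: weighted_seminorm_ge0.
  have eD x : val_at (f + g) x <= val_at f x + val_at g x.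
    rewrite (_ : val (f + g) = 1 *: val f + val g); last by rewrite scale1r.
    rewrite /weighted_value linearP -mulrDl ler_wpM2r//.
    apply: le_trans (real_norm_axpy _ _ _) _.
    by rewrite -(of_real1 R k) real_norm_of_real normr1 mul1r.
  apply: weighted_seminorm_le.
    apply: le_trans (qD _ _) _.
    by rewrite lerD ?weighted_seminorm_ge_q.
  move=> x Ax; apply: le_trans (lerD (qD _ _) (eD x)) _.
  by rewrite addrACA lerD ?weighted_seminorm_ge.
have valZ : val (b *: f) = b *: val f by [].
have eZ x : val_at (b *: f) x = real_norm (b : K) * val_at f x.
  rewrite /weighted_value valZ linearZ /= /real_norm normrZ.
  by rewrite to_realM// mulrA.
have b0 := real_norm_ge0 (b : K).
apply: weighted_seminorm_le => [|x Ax].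
  by rewrite valZ qZ ler_wpM2l// weighted_seminorm_ge_q.
by rewrite eZ valZ qZ -mulrDr ler_wpM2l// weighted_seminorm_ge.
Qed.

Lemma weighted_norm_ge A f : weighted_seminorm q A f <= N f.
Proof. exact: weighted_seminorm_mono. Qed.

(** A real [sup] is an upper bound only for bounded sets; [N f * M] is the bound for the submixed,
    point and weight seminorms alike. *)
Lemma weighted_family_ge (I : Type) (b y : I -> R) (M : R) f i :
  (forall j, 0 <= b j <= M) -> (forall j, 0 <= y j <= N f) ->
  y i * b i <= sup [set y j * b j | j in [set: I]].
Proof.
move=> bM yN; apply: ub_le_sup; last by exists i.
exists (N f * M) => _ [j _ <-]; have /andP[b0 bj] := bM j.
by have /andP[y0 yj] := yN j; exact: ler_pM.
Qed.

Lemma val_at_le_norm f x : 0 <= q (val f) + val_at f x <= N f.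
Proof.
apply/andP; split; first by rewrite addr_ge0.
exact: (@weighted_seminorm_ge setT f x I).
Qed.

Lemma submixed_ge (A : nat -> set Lambda) a f n : null_sequence a ->
  weighted_seminorm q (A n) f * a n <=
  sup [set weighted_seminorm q (A m) f * a m | m in [set: nat]].
Proof.
move=> na; have [M _ aM] := null_sequence_ub na; have [a0 _] := na.
apply: (@weighted_family_ge _ a (fun m => weighted_seminorm q (A m) f) M f n).
  by move=> m; rewrite a0 aM.
by move=> m; rewrite weighted_seminorm_ge0 weighted_norm_ge.
Qed.

Lemma set_sequence_seminorm_ge (A : nat -> set Lambda) a f n x :
  null_sequence a -> A n x ->
  (q (val f) + val_at f x) * a n <= set_sequence_seminorm q A a f.
Proof.
move=> na Ax; have [M M0 aM] := null_sequence_ub na; have [a0 _] := na.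
have bd m y : (q (val f) + val_at f y) * a m <= N f * M.
  by have /andP[y0 yN] := val_at_le_norm f y; apply: ler_pM.
pose inner m := sup [set (q (val f) + val_at f y) * a m | y in A m].
apply: (@le_trans _ _ (inner n)).
  by apply: ub_le_sup; [exists (N f * M) => _ [y _ <-]|exists x].
apply: ub_le_sup; last by exists n.
exists (N f * M) => _ [m _ <-]; apply: sup_le_ge0 => [|_ [y _ <-]//].
by rewrite mulr_ge0// weighted_seminorm_ge0.
Qed.

Lemma point_sequence_seminorm_ge (x : nat -> Lambda) a f n : null_sequence a ->
  (q (val f) + val_at f (x n)) * a n <= point_sequence_seminorm q x a f.
Proof.
move=> na; have [M _ aM] := null_sequence_ub na; have [a0 _] := na.
apply: (@weighted_family_ge _ a (fun m => q (val f) + val_at f (x m)) M f n).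
  by move=> m; rewrite a0 aM.
by move=> m; exact: val_at_le_norm.
Qed.

Lemma weight_seminorm_ge (w : Lambda -> R) f x :
  (forall y, 0 <= w y) -> has_ubound (range w) ->
  (q (val f) + val_at f x) * w x <= weight_seminorm q w f.
Proof.
move=> w0 [M wM].
apply: (@weighted_family_ge _ w (fun y => q (val f) + val_at f y) M f x).
  by move=> y; rewrite w0 wM//; exists y.
by move=> y; exact: val_at_le_norm.
Qed.

(** * Saks space, C-sequentiality and submixed topology for a covering family *)

Section covering.
Context (S : set (set Lambda)).
Hypotheses (S_union : forall A B, S A -> S B -> S (A `|` B))
  (S_cover : \bigcup_(A in S) A = setT) (x0 : Lambda)
  (normed : is_norm N).

Let GammaS : set (V -> R) := weighted_system q S.

Let S_at x : exists2 A, S A & A x.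
Proof. by have : [set: Lambda] x by []; rewrite -S_cover => -[A]; exists A. Qed.

Lemma weighted_saks_system : saks_system N (seminorm_topology GammaS) GammaS.
Proof.
have [A0 SA0 _] := S_at x0; split => //.
- by move=> _ [A _ <-]; exact: weighted_seminorm_seminorm.
- by exists (weighted_seminorm q A0), A0.
- move=> _ _ [A SA <-] [B SB <-]; exists (weighted_seminorm q (A `|` B)).
    by exists (A `|` B) => //; exact: S_union.
  by move=> f; split; apply: weighted_seminorm_mono; [left|right].
- move=> f; apply/le_anti/andP; split; last first.
    apply: ge_ereal_sup => _ [_ [A _ <-] <-].
    by rewrite lee_fin weighted_norm_ge.
  have sup_ge A : S A -> ((weighted_seminorm q A f)%:E <=
      ereal_sup [set (p f)%:E | p in GammaS])%E.
    move=> SA; apply: ereal_sup_ubound.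
    by exists (weighted_seminorm q A) => //; exists A.
  (* The member [A0] excludes [-oo]. A real supremum [r] bounds the norm, because every point lies
     in a member of [S]. *)
  case: ereal_sup sup_ge => [r H||/(_ _ SA0)//]; last by rewrite leey.
  rewrite lee_fin; apply: weighted_seminorm_le => [|x _].
    apply: le_trans (weighted_seminorm_ge_q A0 f) _.
    by rewrite -lee_fin H.
  have [A SA Ax] := S_at x; apply: le_trans (weighted_seminorm_ge f Ax) _.
  by rewrite -lee_fin H.
Qed.

Lemma weighted_saks_space : saks_space N (seminorm_topology GammaS).
Proof.
split => //.
- apply: hausdorff_seminorm_topology.
    by move=> _ [A _ <-]; exact: weighted_seminorm_seminorm.
  move=> f f0; case: normed => _; apply; apply: le_anti.
  rewrite weighted_seminorm_ge0 andbT.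
  have [A0 SA0 _] := S_at x0.
  apply: weighted_seminorm_le => [|x _].
    apply: le_trans (weighted_seminorm_ge_q A0 f) _.
    by rewrite f0//; exists A0.
  have [A SA Ax] := S_at x; apply: le_trans (weighted_seminorm_ge f Ax) _.
  by rewrite f0//; exists A.
- apply: coarser_seminorm => _ [A _ <-].
  apply: (@dominated_subordinate _ _ _ _ _ _ N) => //.
  exact: weighted_norm_ge.
- by exists GammaS; exact: weighted_saks_system.
Qed.

Lemma weighted_C_sequential (A : nat -> set Lambda) : (forall n, S (A n)) ->
  (forall B, S B -> exists n, B `<=` A n) ->
  C_sequential N (seminorm_topology GammaS).
Proof.
(* Cumulative unions stay in [S] and increase, so a set inside one [A n0] is inside [B n] for all
   [n >= n0]. *)
move=> SA cofA; pose B n := \bigcup_(i in `I_n.+1) A i.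
have SB n : S (B n).
  rewrite /B bigcup_mkord; elim: n => [|n IH]; first by rewrite big_ord1.
  by rewrite big_ord_recr /=; exact: S_union.
apply: (@C_sequential_of_cofinal _ _ _ _ _ _ _ _ (fun n => weighted_seminorm q (B n))).
- exact: weighted_seminorm_seminorm.
- by move=> _ [C _ <-]; exact: weighted_seminorm_seminorm.
- by move=> _ [C _ <-] f; exact: weighted_norm_ge.
- by move=> n; exists (B n).
- move=> _ [C SC <-]; have [n0 CA] := cofA C SC.
  exists n0 => n n0n f; apply: weighted_seminorm_mono => x /CA Ax.
  by exists n0.
Qed.

(** Pointwise estimates say nothing on an empty set, whose seminorm is [q]. Adjoining a fixed member
    of [S] that contains [x0] makes all sets non-empty and only increases the seminorms. *)
Let submixed_members (p : nat -> V -> R) a : (forall n, GammaS (p n)) ->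
  exists A : nat -> set Lambda, [/\ forall n, S (A n), forall n, A n !=set0 &
    null_sequence a -> forall f n (c : R),
    (forall x, A n x -> (q (val f) + val_at f x) * a n <= c) -> p n f * a n <= c].
Proof.
move=> Gp; have [A0 SA0 A0x] := S_at x0.
have /choice[A AP] n : exists A, S A /\ weighted_seminorm q A = p n.
  by have [A SA <-] := Gp n; exists A.
exists (fun n => A n `|` A0); split.
- by move=> n; apply: S_union => //; case: (AP n).
- by move=> n; exists x0; right.
- move=> [a0 _] f n c H; have [_ <-] := AP n.
  apply: (@le_trans _ _ (weighted_seminorm q (A n `|` A0) f * a n)).
    by rewrite ler_wpM2r//; apply: weighted_seminorm_mono; left.
  by apply: weighted_seminorm_mul_le => //; exists x0; right.
Qed.

Lemma submixed_set_sequences : submixed_topology GammaS =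
  seminorm_topology [set p | exists (A : nat -> set Lambda) a,
    [/\ forall n, S (A n), null_sequence a & p = set_sequence_seminorm q A a]].
Proof.
apply: eq_seminorm_topology.
  move=> _ [p [a [Gp na ->]]]; have [A [SA A0 pA]] := submixed_members a Gp.
  exists (set_sequence_seminorm q A a); first by exists A, a.
  move=> f; apply: ge_sup; first by exists (p 0%N f * a 0%N), 0%N.
  move=> _ [n _ <-]; apply: pA => // x Ax.
  exact: set_sequence_seminorm_ge.
move=> _ [A [a [SA na ->]]]; have [a0 _] := na.
exists (fun f => sup [set weighted_seminorm q (A n) f * a n | n in [set: nat]]).
  exists (fun n => weighted_seminorm q (A n)), a; split => // n.
  by exists (A n).
move=> f; apply: ge_sup; first by eexists; exists 0%N.
move=> _ [n _ <-].
have ge := @submixed_ge A a f n na.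
apply: sup_le_ge0.
  by apply: le_trans ge; rewrite mulr_ge0// weighted_seminorm_ge0.
move=> _ [x Ax <-]; apply: le_trans ge.
by rewrite ler_wpM2r// weighted_seminorm_ge.
Qed.

Lemma submixed_point_sequences : S = [set A | finite_set A] ->
  submixed_topology GammaS =
    seminorm_topology [set p | exists (x : nat -> Lambda) a,
      null_sequence a /\ p = point_sequence_seminorm q x a].
Proof.
move=> SE; apply: eq_seminorm_topology.
  move=> _ [p [a [Gp na ->]]]; have [A [SA A0 pA]] := submixed_members a Gp.
  (* [{classic Lambda}] provides the decidable equality needed to list finite sets. *)
  have /choice[s sA] n : exists s : seq {classic Lambda}, A n = [set` s].
    by apply/finite_seqP; have := SA n; rewrite SE.
  have [e [b [nb eb]]] := null_sequence_pairs (fun n => size (s n)) na.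
  (* The domination uses only indices [m] that encode a position inside a list; elsewhere any point
     will do. *)
  pose x m := nth (x0 : {classic Lambda}) (s (e m).1) (e m).2.
  exists (point_sequence_seminorm q x b); first by exists x, b.
  move=> f; apply: ge_sup; first by exists (p 0%N f * a 0%N), 0%N.
  move=> _ [n _ <-]; apply: pA => // y; rewrite sA /= => ys.
  have [|m [em bm]] := eb n (index (y : {classic Lambda}) (s n)).
    by rewrite index_mem.
  have := @point_sequence_seminorm_ge x b f m nb.
  by rewrite bm /x em /= nth_index.
move=> _ [x [a [na ->]]]; have [a0 _] := na.
pose A n : set Lambda := [set x n].
exists (fun f => sup [set weighted_seminorm q (A n) f * a n | n in [set: nat]]).
  exists (fun n => weighted_seminorm q (A n)), a; split => // n.
  by exists (A n) => //; rewrite SE; exact: finite_set1.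
move=> f; apply: ge_sup; first by eexists; exists 0%N.
move=> _ [n _ <-]; apply: le_trans (@submixed_ge A a f n na).
by rewrite ler_wpM2r// weighted_seminorm_ge.
Qed.

(** Treats the three weight families of (e) at once: the bounded weights are an upper limit for [W],
    and domination of null sequences on compact sets is a lower one. *)
Lemma submixed_weights (tL : topology Lambda)
  (W : set (topologized tL -> R)) :
  S = [set A | compact (A : set (topologized tL))] ->
  W `<=` bounded_weights R (topologized tL) ->
  (forall (A : nat -> set (topologized tL)) a,
    (forall n, compact (A n)) -> null_sequence a ->
    exists2 w, W w & forall n x, A n x -> a n <= w x) ->
  submixed_topology GammaS = seminorm_topology (weight_seminorm q @` W).
Proof.
move=> SE Wb WA; apply: eq_seminorm_topology.
  move=> _ [p [a [Gp na ->]]]; have [A [SA A0 pA]] := submixed_members a Gp.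
  have cA n : compact (A n : set (topologized tL)) by have := SA n; rewrite SE.
  have [w Ww aw] := WA A a cA na; have [w0 wM _] := Wb w Ww.
  exists (weight_seminorm q w); first by exists w.
  move=> f; apply: ge_sup; first by exists (p 0%N f * a 0%N), 0%N.
  move=> _ [n _ <-]; apply: pA => // x Ax.
  apply: le_trans (weight_seminorm_ge f x w0 wM).
  by rewrite ler_wpM2l ?addr_ge0//; exact: aw.
move=> _ [w Ww <-]; have [w0 _ _] := Wb w Ww.
have [A [a [cA na wA]]] := bounded_weight_exhaustion (Wb w Ww).
have [a0 _] := na.
exists (fun f => sup [set weighted_seminorm q (A n) f * a n | n in [set: nat]]).
  exists (fun n => weighted_seminorm q (A n)), a; split => // n.
  by exists (A n) => //; rewrite SE; exact: cA.
move=> f; have ge n := @submixed_ge A a f n na.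
apply: sup_le_ge0.
  apply: le_trans (ge 0%N).
  by rewrite mulr_ge0// weighted_seminorm_ge0.
(* A zero of [w] may lie in none of the exhausting sets, but it contributes only 0. *)
move=> _ [x _ <-]; have [->|/wA[n Ax wa]] := eqVneq (w x) 0.
  rewrite mulr0; apply: le_trans (ge 0%N).
  by rewrite mulr_ge0// weighted_seminorm_ge0.
apply: le_trans (ge n); apply: ler_pM => //; first by rewrite addr_ge0.
exact: weighted_seminorm_ge.
Qed.

End covering.

End weighted_space_theory.

(** * Assembly of the assertions (a) to (e) *)

Theorem theorem4p3 (R : realType) (k : scalars) (Omega Lambda : Type)
  (Omega_nonempty : inhabited Omega) (Lambda_nonempty : inhabited Lambda)
  (v : Lambda -> {posnum R}) (E : normedModType (scalar_field R k))
  (G : submodClosed (Omega -> E))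
  (q : submodule_of G -> R) (q_seminorm : is_seminorm q)
  (T : {linear submodule_of G -> (Lambda -> E)})
  (normed : is_norm (weighted_norm q : weighted_space v T -> R))
  (S : set (set Lambda))
  (S_union : forall A B, S A -> S B -> S (A `|` B))
  (S_cover : \bigcup_(A in S) A = setT) :
  let N : weighted_space v T -> R := weighted_norm q in
  let GammaS : set (weighted_space v T -> R) := weighted_system q S in
  let tauS : topology (weighted_space v T) := seminorm_topology GammaS in
  [/\ (* (a) *)
      saks_space N tauS,
      (* (b) *)
      (exists A : nat -> set Lambda,
        (forall n, S (A n)) /\ (forall B, S B -> exists n, B `<=` A n)) ->
      C_sequential N tauS,
      (* (c) *)
      saks_system N tauS GammaS /\
      submixed_topology GammaS =
        seminorm_topology [set p | exists (A : nat -> set Lambda) (a : nat -> R),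
          [/\ forall n, S (A n), null_sequence a &
              p = set_sequence_seminorm q A a]],
      (* (d) *)
      S = [set A | finite_set A] ->
      submixed_topology GammaS =
        seminorm_topology [set p | exists (x : nat -> Lambda) (a : nat -> R),
          null_sequence a /\ p = point_sequence_seminorm q x a] &
      (* (e) *)
      forall tL : topology Lambda,
        hausdorff_space (topologized tL) ->
        completely_regular_space (topologized tL) ->
        S = [set A | compact (A : set (topologized tL))] ->
        mixed_topology N tauS = submixed_topology GammaS ->
        [/\ mixed_topology N tauS =
              seminorm_topology
                (weight_seminorm q @` bounded_weights R (topologized tL)),
            mixed_topology N tauS =
              seminorm_topology
                (weight_seminorm q @` usc_weights R (topologized tL)) &
            locally_compact [set: topologized tL] ->
            mixed_topology N tauS =
              seminorm_topology
                (weight_seminorm q @` continuous_weights R (topologized tL))]].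
Proof.
case: Lambda_nonempty => x0; split.
- exact: weighted_saks_space.
- by move=> [A [SA cofA]]; exact: weighted_C_sequential cofA.
- by split; [exact: weighted_saks_system|exact: submixed_set_sequences].
- exact: submixed_point_sequences.
(* The assumed equality replaces the mixed topology by the submixed one, which the weight families
   are known to generate. *)
- move=> tL hL crL SE ->.
  have uscW := usc_weight_of_compacts (R := R) hL.
  split; [| |move=> lcL]; apply: submixed_weights => //.
  + move=> A a cA na; have [w wW aw] := uscW A a cA na.
    by exists w => //; exact: usc_weights_bounded.
  + exact: usc_weights_bounded.
  + by move=> w wc; apply: usc_weights_bounded => //; exact: continuous_weights_usc.
  + exact: continuous_weight_of_compacts.
Qed.
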